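(* For every integer $n\ge 3$ the $(n+6)$-point quadrature formula $$Q_{n+6}[f]=\frac{7}{24n}\sigma(0)-\frac{4}{9n}\sigma\Big(\frac1{4n}\Big)+\frac{7}{6n}\sigma\Big(\frac1{2n}\Big)-\frac{1}{72n}\sigma\Big(\frac1n\Big)+\frac1n\sum_{k=2}^{n-1}f\Big(\frac{2k-1}{2n}\Big),\qquad \sigma(x):=f(x)+f(1-x),$$ is negative definite of order $4$, with error constant $$c_4(Q_{n+6})=-\frac{7}{5760\,n^4}\Big(1-\frac{5}{14\,n}\Big),$$ and the sequence $\{Q_{n+6}\}$ is asymptotically optimal negative definite of order $4$, i.e. $\lim_{n\to\infty}c_4(Q_{n+6})/c^{-}_{n+6,4}=1$.
   Context: An $N$-point quadrature formula is a functional $Q[f]=\sum_{i=1}^{N}a_i f(\tau_i)$ with nodes $0\le\tau_1<\dots<\tau_N\le 1$ and real weights; its remainder is $R[Q;f]=\int_0^1 f(x)\,dx-Q[f]$. $Q$ is negative definite of order $4$, with error constant $c_4(Q)$, if there is a constant $c_4(Q)<0$ such that for every $f\in C^4[0,1]$ there is $\xi\in[0,1]$ with $R[Q;f]=c_4(Q)f^{(4)}(\xi)$. $c^{-}_{N,4}$ denotes the supremum (largest negative value) of $c_4(Q)$ over all $N$-point negative definite quadrature formulae $Q$ of order $4$. *)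

(* Defs.v *)
From Stdlib Require Import Reals.
From Coquelicot Require Import Coquelicot.
Open Scope R_scope.

Definition I01 (x : R) : Prop := 0 <= x <= 1.

(* [D_in] and [continue_in] are relative to I01, so derivatives and limits at
   0 and 1 are one-sided and values of f outside [0,1] are irrelevant. *)
Definition derivative_on01 (f f' : R -> R) : Prop :=
  forall x, I01 x -> D_in f f' I01 x.

Definition continuous_on01 (f : R -> R) : Prop :=
  forall x, I01 x -> continue_in f I01 x.

(* f belongs to C^4[0,1] and f4 is its fourth derivative there. *)
Definition C4_on01 (f f4 : R -> R) : Prop :=
  exists f1 f2 f3 : R -> R,
    derivative_on01 f f1 /\ derivative_on01 f1 f2 /\
    derivative_on01 f2 f3 /\ derivative_on01 f3 f4 /\
    continuous_on01 f4.

Definition is_quadrature (N : nat) (Q : (R -> R) -> R) : Prop :=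
  exists a tau : nat -> R,
    (forall i, (1 <= i <= N)%nat -> 0 <= tau i <= 1) /\
    (forall i j, (1 <= i)%nat -> (i < j)%nat -> (j <= N)%nat -> tau i < tau j) /\
    (forall f : R -> R, Q f = sum_n_m (fun i => a i * f (tau i)) 1 N).

Definition remainder (Q : (R -> R) -> R) (f : R -> R) : R := RInt f 0 1 - Q f.

(* c is determined by Q: test with a monomial of degree 4. *)
Definition negative_definite4 (Q : (R -> R) -> R) (c : R) : Prop :=
  c < 0 /\
  forall f f4 : R -> R, C4_on01 f f4 ->
    exists xi, 0 <= xi <= 1 /\ remainder Q f = c * f4 xi.

(* [Lub_Rbar] is bounded above by 0 here, so [real] returns the genuine
   supremum as soon as one N-point negative definite formula exists. *)
Definition c_minus4 (N : nat) : R :=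
  real (Lub_Rbar (fun c : R =>
    exists Q : (R -> R) -> R, is_quadrature N Q /\ negative_definite4 Q c)).

Definition sigma (f : R -> R) (x : R) : R := f x + f (1 - x).

(* The formula with n + 6 nodes, meaningful for n >= 3. *)
Definition Qform (n : nat) (f : R -> R) : R :=
  7 / (24 * INR n) * sigma f 0
  - 4 / (9 * INR n) * sigma f (1 / (4 * INR n))
  + 7 / (6 * INR n) * sigma f (1 / (2 * INR n))
  - 1 / (72 * INR n) * sigma f (1 / INR n)
  + 1 / INR n *
    sum_n_m (fun k => f ((2 * INR k - 1) / (2 * INR n))) 2 (n - 1).

(* Main.v *)
Require Import Defs.
From Stdlib Require Import Reals Lra Lia Psatz Factorial.
From Coquelicot Require Import Coquelicot.
Open Scope R_scope.

(** Write [kappa = 7 / 5760]. The limit follows from two facts: the given formula has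
    error constant [- kappa / n^4 (1 + O(1 / n))], and no [N]-point negative definite
    formula has an error constant above [- kappa / (N + 1)^4]. The supremum for
    [N = n + 6] is thus squeezed between these two values.

    The given formula. Cut [[0, 1]] at the points [k / n]. On a middle cell the
    formula is the midpoint rule, and the remainder corrected by
    [h^2 / 24] times the difference of the end slopes, with [h = 1 / n], has the
    nonpositive Peano kernel [s^2 (s^2 - h^2 / 2) / 24] ([middle_cell]). The
    corrections telescope, and the special weights near 0 and 1 are such that the two
    remaining slopes are absorbed with a nonpositive kernel again ([left_end],
    [right_end]).

    The upper bound. Let [K] be the Peano kernel of a negative definite formula. It is
    nonpositive ([peano_nonpos]), twice continuously differentiable, it vanishes together with
    its slope at 0 and 1, and between two nodes it is a quartic with leading coefficient
    [1 / 24]; its integral is the error constant. On a single cell of length [L],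
    nonpositivity alone gives only [- L^5 / 2880] for the integral, so the smoothness across
    the nodes must be used although the positions of the nodes are unknown. This is done by a
    potential, a function of [K'] and [K''] that is continuous across the nodes and
    whose increment over each cell pays for the deficit of that cell. For a quartic
    on a cell of length [L], with value [- m] at the midpoint,

      integral of K = - kappa L^5 + [K' K'' / 2] - L m - [K']^2 / (2 L) - M [K''] / 2,

    where [[.]] is the increment over the cell and [M] the mean of the two end
    slopes. The last three terms have a nonpositive sum unless [K] is extremely negative in
    mean ([quart_increment]). Hence [K' K'' / 2] is almost a potential with
    the required property, and truncating it at [11 / 10 kappa H^5] in absolute value makes
    it one: the integral of [K] plus [kappa (5 H^4 L - 4 H^5)] is at most the increment of
    the truncated potential ([cell_increment]). Since [5 H^4 L - 4 H^5] is affine in [L],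
    the sum over all cells does not depend on the positions of the nodes, and
    [H = 1 / (N + 1)] gives the bound ([definite_upper_bound]). *)

(** * Nonpositive quartics on one cell *)

Definition clamp (b x : R) : R := Rmax (- b) (Rmin b x).

(** The right-hand side exceeds the left-hand side by [(u - z)^2] times a
    polynomial with nonnegative coefficients. *)
Lemma quintic_tangent z u : 0 <= z -> 0 <= u -> 5 * z * u ^ 4 <= 4 * u ^ 5 + z ^ 5.
Proof.
intros Hz Hu.
assert (H : 0 <= (u - z) ^ 2 * (4 * u ^ 3 + 3 * z * u ^ 2 + 2 * z ^ 2 * u + z ^ 3)).
{ apply Rmult_le_pos; [apply pow2_ge_0|].
  repeat apply Rplus_le_le_0_compat; repeat apply Rmult_le_pos; try apply pow_le; lra. }
replace (4 * u ^ 5 + z ^ 5) with (5 * z * u ^ 4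
  + (u - z) ^ 2 * (4 * u ^ 3 + 3 * z * u ^ 2 + 2 * z ^ 2 * u + z ^ 3)) by ring.
lra.
Qed.

Definition quart (c p q m s : R) := s ^ 4 + c * s ^ 3 + p * s ^ 2 + q * s - m.
Definition nonpos_quart c p q m := forall s, -1 <= s <= 1 -> quart c p q m s <= 0.

(** The slope [q] at the midpoint is paid for by the depth [m] there, because a
    nonpositive quartic cannot rise for long. For small [q] the test point [q / 8]
    gives this, with the part of [p] far from [-2] absorbed by the square; for
    large [q] the endpoint [1] does, and the bound on [2 m - 2 p / 3], that is on the
    integral of the quartic, keeps [q] below 52. *)
Lemma mid_slope_bound c p q m :
  nonpos_quart c p q m -> 0 <= q -> 0 <= 3 * c + q ->
  2 * m - 2 / 3 * p <= 116 / 5 ->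
  q ^ 2 <= 96 * m + 8 * (p + 2) ^ 2.
Proof.
intros Hk Hq Hc Hb.
assert (H1 := Hk 1 ltac:(lra)); assert (H2 := Hk 0 ltac:(lra)).
unfold quart in H1, H2.
assert (Hq2 : q <= 52) by lra.
destruct (Rle_lt_dec q 8) as [H8|H8].
- assert (H3 := Hk (q / 8) ltac:(lra)); unfold quart in H3.
  assert (H4 : - (q / 3) * (q/8) ^ 3 <= c * (q / 8) ^ 3).
  { apply Rmult_le_compat_r; [apply pow_le|]; lra. }
  assert (H5 : 0 <= (p + 2 + 6 * (q / 8) ^ 2) ^ 2) by apply pow2_ge_0.
  assert (H6 : q ^ 2 <= 64) by nra.
  nra.
- assert (H5 : 0 <= (p + 2 - 6) ^ 2) by apply pow2_ge_0.
  assert (H6 : 0 <= (q - 8) * (52 - q)) by nra.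
  nra.
Qed.

(** Integral of [quart c p q m] over [[-1, 1]]. *)
Definition quart_int (p m : R) := 2 / 5 + 2 / 3 * p - 2 * m.
(** [k' k'' / 48] at the ends [1] and [-1], for [k = quart c p q m]. This is
    24 times [K' K'' / 2] for the kernel [K = k / 24]. *)
Definition potential_right (c p q : R) := (4 + 3 * c + 2 * p + q) * (12 + 6 * c + 2 * p) / 48.
Definition potential_left (c p q : R) := (- 4 + 3 * c - 2 * p + q) * (12 - 6 * c + 2 * p) / 48.

Lemma nonpos_reflect c p q m : nonpos_quart c p q m -> nonpos_quart (- c) p (- q) m.
Proof.
intros H s Hs. generalize (H (- s) ltac:(lra)). unfold quart. nra.
Qed.

Lemma potential_right_reflect c p q : potential_right (- c) p (- q) = - potential_left c p q.
Proof. unfold potential_right, potential_left. field. Qed.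

(** The heart of the estimate. The gain of potential over the cell exceeds the
    integral plus [14 / 15] by exactly
    [(p + 2)^2 / 6 + 2 m + c (3 c + q) / 4]: the first two terms are the
    square of the increment [4 (p + 2)] of the slope, up to a factor, and the depth at
    the midpoint. The third one is at least [- q^2 / 48], and [mid_slope_bound]
    compensates it as long as the integral is not too negative. *)
Lemma quart_increment c p q m :
  nonpos_quart c p q m -> - quart_int p m <= 114 / 5 ->
  quart_int p m + 14 / 15 <= potential_right c p q - potential_left c p q.
Proof.
intros Hk Hb. unfold quart_int in *.
replace (potential_right c p q - potential_left c p q) with
  (2 / 5 + 2 / 3 * p - 2 * m + 14 / 15
   + ((p + 2) ^ 2 / 6 + 2 * m + c * (3 * c + q) / 4))
  by (unfold potential_right, potential_left; field).
assert (Hp := pow2_ge_0 (p + 2)).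
assert (Hm := Hk 0 ltac:(lra)). unfold quart in Hm.
destruct (Rle_lt_dec 0 (c * (3 * c + q))) as [H|H]; [lra|].
assert (Hs : q ^ 2 <= 96 * m + 8 * (p + 2) ^ 2).
{ destruct (Rle_lt_dec 0 q) as [Hq|Hq].
  - apply mid_slope_bound with (c := c); try lra; trivial. nra.
  - replace (q ^ 2) with ((- q) ^ 2) by ring.
    apply mid_slope_bound with (c := - c); try lra; [|nra].
    now apply nonpos_reflect. }
assert (0 <= (6 * c + q) ^ 2) by apply pow2_ge_0.
nra.
Qed.

(** If the kernel is small in mean, then its jets at the ends are bounded, and the
    potential at an end cannot be very negative. In terms of [a = k'(1)] and
    [d = k''(1) / 2], nonpositivity at the four points [1], [1 / 5], [0], [-1]
    bounds the integral by linear functions of [a] and [d], and these settle each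
    sign pattern of [a] and [d]. *)
Lemma potential_right_lower c p q m :
  nonpos_quart c p q m -> - quart_int p m <= 14 / 15 ->
  quart_int p m + 3533 / 10000 <= potential_right c p q.
Proof.
intros Hk Hb.
assert (H0 := Hk 1 ltac:(lra)); assert (H1 := Hk 0 ltac:(lra)).
assert (H2 := Hk (-1) ltac:(lra)); assert (H3 := Hk (1 / 5) ltac:(lra)).
unfold quart, quart_int, potential_right in *.
set (a := 4 + 3 * c + 2 * p + q). set (d := 6 + 3 * c + p).
replace (a * (12 + 6 * c + 2 * p) / 48) with (a * d / 24) by (unfold d; field).
assert (Ea : q = a - 4 - 3 * c - 2 * p) by (unfold a; ring).
assert (Ed : p = d - 6 - 3 * c) by (unfold d; ring).
clearbody a d. subst q. subst p.
destruct (Rle_lt_dec a 0) as [Ha|Ha]; destruct (Rle_lt_dec 0 d) as [Hd|Hd].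
(* For a < 0 < d, nonpositivity at 0 and -1 suffices if d is large, at 1/5 and -1
   if d is small; the bound on the integral keeps d below 13/2. *)
- destruct (Rle_lt_dec (247 / 100) d) as [Hd'|Hd'].
  + assert (0 <= (- a) * (13 / 2 - d)) by (apply Rmult_le_pos; lra). lra.
  + assert (0 <= (- a) * (247 / 100 - d)) by (apply Rmult_le_pos; lra). lra.
- assert (0 <= (- a) * (- d)) by (apply Rmult_le_pos; lra). lra.
- destruct (Rle_lt_dec a (17 / 20)) as [Ha'|Ha'].
  + assert (0 <= a * d) by (apply Rmult_le_pos; lra). lra.
  + destruct (Rle_lt_dec d 3) as [Hd'|Hd'].
    * assert (0 <= a * d) by (apply Rmult_le_pos; lra). lra.
    * assert (0 <= a * (d - 3)) by (apply Rmult_le_pos; lra). lra.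
- exfalso. lra.
Qed.

(** What remains of an inequality [t <= y - x] when [x] and [y] are truncated: it
    is automatic for [t] below [- 2 b], it survives truncation for other negative [t]
    because [clamp] is nondecreasing and contracts distances, and for positive
    [t] neither value may be moved too far by the truncation. *)
Lemma clamp_increment b t x y :
  t <= 2 * b -> (- (2 * b) <= t -> t <= y - x) ->
  (0 < t -> t - b <= y /\ x <= b - t) -> 0 <= b ->
  t <= clamp b y - clamp b x.
Proof.
intros H1 H2 H3 Hb. unfold clamp, Rmax, Rmin.
destruct (Rle_lt_dec (- (2 * b)) t) as [Ht|Ht];
  [specialize (H2 Ht)|clear H2];
  (destruct (Rle_lt_dec t 0) as [Hn|Hn]; [clear H3|destruct (H3 Hn)]);
  repeat destruct Rle_dec; lra.
Qed.

Lemma clamp_scale r b x : 0 <= r -> clamp (r * b) (r * x) = r * clamp b x.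
Proof.
intros Hr. unfold clamp.
now rewrite <- Rmult_min_distr_l, Ropp_mult_distr_r, RmaxRmult.
Qed.

(** The cell inequality for [k / 24] on [[-1, 1]], multiplied by 24. Here [u] stands for
    [H / 2], with [H] the reference length, so that [14 / 15 u^5] is [24 kappa H^5]. A very
    negative integral makes the inequality trivial, since the truncated potential varies
    by at most twice its bound; otherwise [quart_increment] applies. In the remaining case of a positive left-hand side, [potential_right_lower],
    used at both ends, shows that the truncation does no harm. *)
Lemma unit_cell_increment c p q m u :
  nonpos_quart c p q m -> 0 <= u ->
  quart_int p m + 14 / 15 * (5 * u ^ 4 - 4 * u ^ 5)
    <= clamp (77 / 75 * u ^ 5) (potential_right c p q)
       - clamp (77 / 75 * u ^ 5) (potential_left c p q).
Proof.
intros Hk Hu.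
(* Each value of z is the maximum point of one of the four combinations of u^4
   and u^5 that occur below. *)
assert (Z1 := quintic_tangent 1 u ltac:(lra) Hu).
assert (Z2 := quintic_tangent (20 / 9) u ltac:(lra) Hu).
assert (Z3 := quintic_tangent (40 / 51) u ltac:(lra) Hu).
assert (Z4 := quintic_tangent (20 / 31) u ltac:(lra) Hu).
assert (Hu5 : 0 <= u ^ 5) by now apply pow_le.
assert (Hk' := nonpos_reflect _ _ _ _ Hk).
apply clamp_increment; [| | |lra].
- assert (H0 := Hk 1 ltac:(lra)); assert (H1 := Hk 0 ltac:(lra)).
  assert (H2 := Hk (-1) ltac:(lra)). unfold quart, quart_int in *. lra.
- intros Ht. assert (H := quart_increment c p q m Hk). lra.
- intros Ht. split.
  + assert (H := potential_right_lower c p q m Hk). lra.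
  + assert (H := potential_right_lower (- c) p (- q) m Hk'). rewrite potential_right_reflect in H. lra.
Qed.

(** With the Bernoulli polynomial [B4] this is [B4(1/2) / 24]: minus the mean of
    [(B4 - B4(1/2)) / 24], whose periodic extension is the nonpositive kernel
    with equidistant knots at unit distance. *)
Definition kappa := 7 / 5760.

(** On [[l, r]] the four functions are a primitive of a quartic with leading
    coefficient [1 / 24], that quartic, and its first two derivatives. *)
Definition quartic_on (A K K1 K2 : R -> R) (l r : R) :=
  exists c p q m C, forall t, l <= t <= r ->
    let x := t - (l + r) / 2 in
    A t = (x ^ 5 / 5 + c * x ^ 4 / 4 + p * x ^ 3 / 3 + q * x ^ 2 / 2 - m * x) / 24 + C /\
    K t = (x ^ 4 + c * x ^ 3 + p * x ^ 2 + q * x - m) / 24 /\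
    K1 t = (4 * x ^ 3 + 3 * c * x ^ 2 + 2 * p * x + q) / 24 /\
    K2 t = (12 * x ^ 2 + 6 * c * x + 2 * p) / 24.

(** Truncation is indispensable: without it the cell inequality fails for kernels
    with large third derivative. A larger factor than [11 / 10] would ease the estimate
    [potential_right_lower] at the ends, a smaller one the estimate
    [quart_increment]; this value leaves room for both. *)
Definition potential H (K1 K2 : R -> R) t := clamp (11 / 10 * kappa * H ^ 5) (K1 t * K2 t / 2).

(** [unit_cell_increment] after rescaling the cell to [[-1, 1]]. The left-hand side
    is affine in the length of the cell, so it can be summed over cells of unknown
    lengths; it comes from the bound [- kappa L^5] by taking the tangent at
    [L = H]. *)
Lemma cell_increment A K K1 K2 l r H :
  l <= r -> 0 <= H -> quartic_on A K K1 K2 l r ->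
  (forall t, l <= t <= r -> K t <= 0) ->
  A r - A l + kappa * (5 * H ^ 4 * (r - l) - 4 * H ^ 5)
    <= potential H K1 K2 r - potential H K1 K2 l.
Proof.
intros Hlr HH (c & p & q & m & C & Hq) HK.
destruct (Req_dec l r) as [->|Hne].
{ assert (0 <= H ^ 5) by now apply pow_le. unfold kappa. nra. }
set (e := (r - l) / 2). assert (He : 0 < e) by (unfold e; lra).
set (z := (l + r) / 2).
assert (Hk : nonpos_quart (c / e) (p / e ^ 2) (q / e ^ 3) (m / e ^ 4)).
{ intros s Hs.
  assert (Ht : l <= z + e * s <= r) by (unfold z, e; nra).
  generalize (HK _ Ht). destruct (Hq _ Ht) as (_ & E & _). rewrite E.
  fold z. replace (z + e * s - z) with (e * s) by ring. intros Hle.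
  apply Rmult_le_reg_l with (e ^ 4); [now apply pow_lt|].
  unfold quart. field_simplify; lra. }
destruct (Hq r ltac:(lra)) as (Ar & _ & K1r & K2r).
destruct (Hq l ltac:(lra)) as (Al & _ & K1l & K2l).
fold z in Ar, K1r, K2r, Al, K1l, K2l.
replace (r - z) with e in * by (unfold e, z; field).
replace (l - z) with (- e) in * by (unfold e, z; field).
assert (Hc := unit_cell_increment _ _ _ _ (H / (2 * e)) Hk
                (Rdiv_le_0_compat H (2 * e) HH ltac:(lra))).
assert (He5 : 0 <= e ^ 5 / 24) by (assert (0 < e ^ 5) by (now apply pow_lt); lra).
apply Rmult_le_compat_l with (1 := He5) in Hc.
match type of Hc with _ <= _ * (?x - ?y) =>
  rewrite (Rmult_minus_distr_l _ x y), <- !clamp_scale in Hc by exact He5 end.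
unfold potential. rewrite K1r, K2r, K1l, K2l, Ar, Al.
replace (r - l) with (2 * e) by (unfold e; field).
replace (11 / 10 * kappa * H ^ 5) with (e ^ 5 / 24 * (77 / 75 * (H / (2 * e)) ^ 5))
  by (unfold kappa; field; lra).
match goal with |- _ <= clamp _ ?x - clamp _ ?y =>
  replace x with (e ^ 5 / 24 * potential_right (c / e) (p / e ^ 2) (q / e ^ 3))
    by (unfold potential_right; field; lra);
  replace y with (e ^ 5 / 24 * potential_left (c / e) (p / e ^ 2) (q / e ^ 3))
    by (unfold potential_left; field; lra) end.
eapply Rle_trans; [|exact Hc]. right.
unfold quart_int, kappa. field. lra.
Qed.

(** * Truncated powers *)

Definition pos (x : R) : R := Rmax x 0.
Definition tpow (k : nat) (s x : R) : R := / INR (fact k) * pos (x - s) ^ k.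

Lemma pos_nonneg x : 0 <= x -> pos x = x.
Proof. intros; now apply Rmax_left. Qed.
Lemma pos_nonpos x : x <= 0 -> pos x = 0.
Proof. intros; now apply Rmax_right. Qed.

Lemma continuous_pos x : continuous pos x.
Proof.
apply continuous_ext with (fun y => (y + Rabs y) / 2).
{ intros y. unfold pos, Rmax, Rabs. destruct Rle_dec, Rcase_abs; lra. }
apply (continuous_mult (fun y => y + Rabs y) (fun _ => / 2)); [|apply continuous_const].
apply (continuous_plus (fun y => y) Rabs); [apply continuous_id|apply continuous_Rabs].
Qed.

Lemma is_derive_pos_pow k x :
  is_derive (fun y => pos y ^ S (S k)) x (INR (S (S k)) * pos x ^ S k).
Proof.
destruct (Rtotal_order x 0) as [H|[H|H]].
- rewrite pos_nonpos by lra. rewrite (pow_i (S k)) by lia. rewrite Rmult_0_r.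
  apply is_derive_ext_loc with (fun _ => 0); [|apply @is_derive_const].
  apply locally_interval with m_infty 0; simpl; trivial.
  intros y _ Hy. rewrite pos_nonpos by lra. ring.
- subst x. rewrite pos_nonpos by lra. rewrite (pow_i (S k)) by lia. rewrite Rmult_0_r.
  apply is_derive_Reals. intros eps Heps.
  assert (Hd : 0 < Rmin eps 1) by (apply Rmin_pos; lra).
  exists (mkposreal _ Hd). intros h Hh Hlt. simpl in Hlt.
  assert (H1 := Rmin_l eps 1). assert (H2 := Rmin_r eps 1).
  rewrite Rplus_0_l, (pos_nonpos 0) by lra. rewrite (pow_i (S (S k))) by lia.
  rewrite !Rminus_0_r.
  destruct (Rle_lt_dec h 0) as [Hn|Hp].
  + rewrite pos_nonpos by lra. rewrite pow_i by lia.
    unfold Rdiv. rewrite Rmult_0_l, Rabs_R0. lra.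
  + rewrite pos_nonneg by lra. rewrite Rabs_pos_eq in Hlt by lra.
    replace (h ^ S (S k) / h) with (h * h ^ k) by (simpl; field; lra).
    assert (0 <= h ^ k <= 1).
    { split; [apply pow_le; lra|]. rewrite <- (pow1 k). apply pow_incr; lra. }
    rewrite Rabs_pos_eq by nra. nra.
- rewrite pos_nonneg by lra.
  apply is_derive_ext_loc with (fun y => y ^ S (S k)).
  { apply locally_interval with 0 p_infty; simpl; trivial.
    intros y Hy _. now rewrite pos_nonneg by lra. }
  evar_last. apply (is_derive_pow (fun y => y) (S (S k)) x 1 (is_derive_id x)).
  simpl Init.Nat.pred. ring.
Qed.

Lemma is_derive_tpow k s x : is_derive (tpow (S (S k)) s) x (tpow (S k) s x).
Proof.
unfold tpow.
assert (H : is_derive (fun y => pos (y - s) ^ S (S k)) x (INR (S (S k)) * pos (x - s) ^ S k)).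
{ assert (Hg : is_derive (fun y => y - s) x 1) by (auto_derive; [trivial|ring]).
  evar_last. exact (is_derive_comp (fun y => pos y ^ S (S k)) (fun y => y - s) x _ _
           (is_derive_pos_pow k (x - s)) Hg).
  unfold scal; simpl; unfold mult; simpl. ring. }
evar_last. exact (is_derive_scal (fun y => pos (y - s) ^ S (S k)) x (/ INR (fact (S (S k)))) _ H).
change (fact (S (S k))) with (S (S k) * fact (S k))%nat.
rewrite mult_INR. field. split; [apply INR_fact_neq_0|apply not_0_INR; lia].
Qed.

Lemma is_derive_tpow_knot k s x :
  is_derive (fun t => tpow (S (S k)) t x) s (- tpow (S k) s x).
Proof.
unfold tpow.
assert (H : is_derive (fun t => pos (x - t) ^ S (S k)) s (- (INR (S (S k)) * pos (x - s) ^ S k))).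
{ assert (Hg : is_derive (fun t => x - t) s (- 1)) by (auto_derive; [trivial|ring]).
  evar_last. exact (is_derive_comp (fun y => pos y ^ S (S k)) (fun t => x - t) s _ _
           (is_derive_pos_pow k (x - s)) Hg).
  unfold scal; simpl; unfold mult; simpl. ring. }
evar_last. exact (is_derive_scal (fun t => pos (x - t) ^ S (S k)) s (/ INR (fact (S (S k)))) _ H).
change (fact (S (S k))) with (S (S k) * fact (S k))%nat.
rewrite mult_INR. field. split; [apply INR_fact_neq_0|apply not_0_INR; lia].
Qed.

Lemma continuous_tpow k s x : continuous (tpow k s) x.
Proof.
unfold tpow. apply (continuous_mult (fun _ => / INR (fact k)) (fun y => pos (y - s) ^ k));
  [apply continuous_const|].
induction k as [|k IH]; simpl; [apply continuous_const|].
apply (continuous_mult (fun y => pos (y - s)) (fun y => pos (y - s) ^ k)); trivial.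
apply (continuous_comp (fun y => y - s) pos); [|apply continuous_pos].
apply (continuous_minus (fun y => y) (fun _ => s)); [apply continuous_id|apply continuous_const].
Qed.

Lemma is_RInt_tpow k s : 0 <= s <= 1 ->
  is_RInt (tpow (S k) s) 0 1 ((1 - s) ^ S (S k) / INR (fact (S (S k)))).
Proof.
intros Hs. evar_last.
apply (is_RInt_derive (tpow (S (S k)) s) (tpow (S k) s)).
- intros; apply is_derive_tpow.
- intros; apply continuous_tpow.
- unfold tpow. rewrite pos_nonneg by lra. rewrite pos_nonpos by lra.
  rewrite (pow_i (S (S k))) by lia. match goal with |- minus ?a ?b = ?c => change (a - b = c) end.
  unfold Rdiv. ring.
Qed.

Lemma derivative_on01_is_derive f f' :
  (forall x, is_derive f x (f' x)) -> derivative_on01 f f'.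
Proof.
intros H x Hx. apply D_in_imp with no_cond; [now intros|].
apply derivable_pt_lim_D_in, is_derive_Reals, H.
Qed.

Lemma continuous_on01_continuous f : (forall x, continuous f x) -> continuous_on01 f.
Proof.
intros H x Hx eps Heps.
destruct (proj2 (continuity_pt_filterlim f x) (H x) eps Heps) as (d & Hd & Hf).
exists d; split; trivial. intros y [[_ Hy] Hyd]. apply Hf. repeat split; trivial.
Qed.

Lemma is_derive_lin3 f g h f' g' h' a b c x :
  is_derive f x f' -> is_derive g x g' -> is_derive h x h' ->
  is_derive (fun y => a * f y + b * g y + c * h y) x (a * f' + b * g' + c * h').
Proof.
intros Hf Hg Hh. apply @is_derive_plus; [apply @is_derive_plus|]; now apply is_derive_scal.
Qed.

(** Second difference in the knot; for [k = 1] this is the hat function on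
    [[t - e, t + e]], so [hat 5 t e] is a test function whose fourth derivative is
    nonnegative and concentrated near [t]. *)
Definition hat k t e x := 1 * tpow k (t + e) x + (- 2) * tpow k t x + 1 * tpow k (t - e) x.

Lemma C4_hat t e : C4_on01 (hat 5 t e) (hat 1 t e).
Proof.
exists (hat 4 t e), (hat 3 t e), (hat 2 t e).
repeat split; try (apply derivative_on01_is_derive; intros x; apply is_derive_lin3; apply is_derive_tpow).
apply continuous_on01_continuous. intros x.
apply (continuous_plus (fun y => 1 * tpow 1 (t + e) y + -2 * tpow 1 t y) (fun y => 1 * tpow 1 (t - e) y));
 [apply (continuous_plus (fun y => 1 * tpow 1 (t + e) y) (fun y => -2 * tpow 1 t y))|];
 apply (continuous_mult (fun _ => _) (tpow 1 _)); try apply continuous_const; apply continuous_tpow.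
Qed.

Lemma hat_nonneg t e x : 0 <= hat 1 t e x.
Proof.
unfold hat, tpow, pos, Rmax. simpl. repeat destruct Rle_dec; lra.
Qed.

(** * The Peano kernel of a definite formula *)

Definition nodal (a tau : nat -> R) (N : nat) (f : R -> R) : R :=
  sum_n_m (fun i => a i * f (tau i)) 1 N.

Lemma nodal_0 a tau f : nodal a tau 0 f = 0.
Proof. unfold nodal. now rewrite sum_n_m_zero by lia. Qed.

Lemma nodal_S a tau N f : nodal a tau (S N) f = nodal a tau N f + a (S N) * f (tau (S N)).
Proof. unfold nodal. rewrite sum_n_Sm by lia. reflexivity. Qed.

Lemma nodal_lin3 a tau N f g h u v w :
  nodal a tau N (fun x => u * f x + v * g x + w * h x)
  = u * nodal a tau N f + v * nodal a tau N g + w * nodal a tau N h.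
Proof.
induction N as [|N IH]; [rewrite !nodal_0|rewrite !nodal_S, IH]; ring.
Qed.

Lemma nodal_ext a tau N f g :
  (forall i, (1 <= i <= N)%nat -> f (tau i) = g (tau i)) -> nodal a tau N f = nodal a tau N g.
Proof.
intros H. apply sum_n_m_ext_loc. intros i Hi. now rewrite H.
Qed.

Lemma is_derive_eq (f : R -> R) (x a b : R) : is_derive f x a -> a = b -> is_derive f x b.
Proof. now intros H <-. Qed.

Lemma is_derive_nodal_knot a tau N k s :
  is_derive (fun t => nodal a tau N (tpow (S (S k)) t)) s (- nodal a tau N (tpow (S k) s)).
Proof.
induction N as [|N IH].
- apply is_derive_ext with (fun _ => 0); [intros; now rewrite nodal_0|].
  rewrite nodal_0, Ropp_0. apply @is_derive_const.
- apply is_derive_ext with (fun t => nodal a tau N (tpow (S (S k)) t)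
    + a (S N) * tpow (S (S k)) t (tau (S N))); [intros; now rewrite nodal_S|].
  apply is_derive_eq with (- nodal a tau N (tpow (S k) s) + a (S N) * - tpow (S k) s (tau (S N)));
    [|rewrite nodal_S; ring].
  apply @is_derive_plus; trivial. apply is_derive_scal, is_derive_tpow_knot.
Qed.

(** The remainder applied to the truncated power [tpow k s], as a function of the
    knot [s]. [peano a tau N 3] is the Peano kernel of order 4; the other indices
    give, up to sign, its primitive and its derivatives. *)
Definition peano a tau N k s :=
  (1 - s) ^ S k / INR (fact (S k)) - nodal a tau N (tpow k s).

Lemma is_derive_peano a tau N k s :
  is_derive (peano a tau N (S (S k))) s (- peano a tau N (S k) s).
Proof.
unfold peano.
apply is_derive_eq with
  (- ((1 - s) ^ S (S k) / INR (fact (S (S k)))) - - nodal a tau N (tpow (S k) s)); [|ring].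
apply @is_derive_minus; [|apply is_derive_nodal_knot].
set (j := S (S k)).
apply is_derive_ext with (fun s => / INR (fact (S j)) * (1 - s) ^ S j);
  [intros t; unfold Rdiv; now rewrite Rmult_comm|].
assert (Hg : is_derive (fun t => 1 - t) s (- 1)) by (auto_derive; [trivial|ring]).
eapply is_derive_eq. apply is_derive_scal. exact (is_derive_pow (fun t => 1 - t) (S j) s _ Hg).
change (fact (S j)) with (S j * fact j)%nat. rewrite mult_INR.
simpl Init.Nat.pred. field. split; [apply INR_fact_neq_0|apply not_0_INR; lia].
Qed.

Lemma remainder_tpow a tau N k s : 0 <= s <= 1 ->
  remainder (nodal a tau N) (tpow (S k) s) = peano a tau N (S k) s.
Proof.
intros Hs. unfold remainder, peano.
now rewrite (is_RInt_unique _ _ _ _ (is_RInt_tpow k s Hs)).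
Qed.

Lemma remainder_hat a tau N k t e : 0 <= t - e -> t + e <= 1 -> 0 <= e ->
  remainder (nodal a tau N) (hat (S k) t e)
  = peano a tau N (S k) (t + e) - 2 * peano a tau N (S k) t + peano a tau N (S k) (t - e).
Proof.
intros H1 H2 He.
assert (HI : is_RInt (hat (S k) t e) 0 1
   (1 * ((1 - (t + e)) ^ S (S k) / INR (fact (S (S k))))
    + (- 2) * ((1 - t) ^ S (S k) / INR (fact (S (S k))))
    + 1 * ((1 - (t - e)) ^ S (S k) / INR (fact (S (S k)))))).
{ apply @is_RInt_plus; [apply @is_RInt_plus|]; apply @is_RInt_scal; apply is_RInt_tpow; lra. }
unfold remainder. rewrite (is_RInt_unique _ _ _ _ HI). unfold hat. rewrite nodal_lin3.
unfold peano. ring.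
Qed.

(** Testing with [hat 5 t e] shows that the second differences of [peano 5] are
    nonpositive, and [peano 3] is the second derivative of [peano 5]. *)
Lemma peano_nonpos a tau N c t :
  negative_definite4 (nodal a tau N) c -> 0 < t < 1 -> peano a tau N 3 t <= 0.
Proof.
intros [Hc HQ] Ht. apply Rnot_lt_le. intros HK.
assert (Cont : continuity_pt (peano a tau N 3) t).
{ apply derivable_continuous_pt. exists (- peano a tau N 2 t).
  apply is_derive_Reals, is_derive_peano. }
destruct (Cont _ HK) as (d & Hd & Hnear).
assert (Hpos : forall s, Rabs (s - t) < d -> 0 < peano a tau N 3 s).
{ intros s Hs. destruct (Req_dec t s) as [<-|Hne]; trivial.
  assert (H := Hnear s (conj (conj I Hne) Hs)). simpl in H. unfold Rdist in H.
  apply Rabs_def2 in H. lra. }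
set (e := Rmin (d / 2) (Rmin t (1 - t))).
assert (He : 0 < e) by (repeat apply Rmin_pos; lra).
assert (He1 : e <= d / 2) by apply Rmin_l.
assert (He2 : e <= t) by (eapply Rle_trans; [apply Rmin_r|apply Rmin_l]).
assert (He3 : e <= 1 - t) by (eapply Rle_trans; [apply Rmin_r|apply Rmin_r]).
destruct (HQ _ _ (C4_hat t e)) as (xi & _ & HR).
assert (Hxi := hat_nonneg t e xi).
rewrite (remainder_hat a tau N 4) in HR by lra.
assert (D5 : forall s, derivable_pt_lim (peano a tau N 5) s (- peano a tau N 4 s))
  by (intros; apply is_derive_Reals, is_derive_peano).
assert (D4 : forall s, derivable_pt_lim (peano a tau N 4) s (- peano a tau N 3 s))
  by (intros; apply is_derive_Reals, is_derive_peano).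
destruct (MVT_cor2 (peano a tau N 5) _ t (t + e) ltac:(lra) (fun s _ => D5 s)) as (x1 & E1 & L1).
destruct (MVT_cor2 (peano a tau N 5) _ (t - e) t ltac:(lra) (fun s _ => D5 s)) as (x2 & E2 & L2).
destruct (MVT_cor2 (peano a tau N 4) _ x2 x1 ltac:(lra) (fun s _ => D4 s)) as (x3 & E3 & L3).
assert (H3 := Hpos x3 ltac:(apply Rabs_def1; lra)).
assert (0 < e * (peano a tau N 3 x3 * (x1 - x2))) by (repeat apply Rmult_lt_0_compat; lra).
nra.
Qed.

(** * Upper bound for the error constant of every definite formula *)

Definition monom (k : nat) (x : R) : R := / INR (fact k) * x ^ k.

Lemma is_derive_monom k x : is_derive (monom (S k)) x (monom k x).
Proof.
unfold monom. eapply is_derive_eq.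
apply is_derive_scal. exact (is_derive_pow (fun t => t) (S k) x _ (is_derive_id x)).
change (fact (S k)) with (S k * fact k)%nat. rewrite mult_INR. change (@one R_AbsRing) with 1.
simpl Init.Nat.pred. field. split; [apply INR_fact_neq_0|apply not_0_INR; lia].
Qed.

Lemma is_derive_monom_0 x : is_derive (monom 0) x 0.
Proof.
apply is_derive_ext with (fun _ => / INR (fact 0) * 1); [reflexivity|]. apply @is_derive_const.
Qed.

Lemma C4_monom_4 : C4_on01 (monom 4) (fun _ => 1).
Proof.
exists (monom 3), (monom 2), (monom 1).
repeat split; try (apply derivative_on01_is_derive; intros; apply is_derive_monom).
- apply derivative_on01_is_derive; intros. eapply is_derive_eq; [apply is_derive_monom|].
  unfold monom; simpl; field.
- apply continuous_on01_continuous. intros; apply continuous_const.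
Qed.

Lemma C4_monom_3 : C4_on01 (monom 3) (fun _ => 0).
Proof.
exists (monom 2), (monom 1), (monom 0).
repeat split; try (apply derivative_on01_is_derive; intros; apply is_derive_monom).
- apply derivative_on01_is_derive; intros. apply is_derive_monom_0.
- apply continuous_on01_continuous. intros; apply continuous_const.
Qed.

Lemma C4_monom_2 : C4_on01 (monom 2) (fun _ => 0).
Proof.
exists (monom 1), (monom 0), (fun _ => 0).
repeat split; try (apply derivative_on01_is_derive; intros; apply is_derive_monom).
- apply derivative_on01_is_derive; intros. apply is_derive_monom_0.
- apply derivative_on01_is_derive; intros. apply @is_derive_const.
- apply continuous_on01_continuous. intros; apply continuous_const.
Qed.

Lemma tpow_0 k x : 0 <= x -> tpow k 0 x = monom k x.
Proof. intros Hx. unfold tpow, monom. rewrite pos_nonneg by lra. now rewrite Rminus_0_r. Qed.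

Section Peano.

Variables (a tau : nat -> R) (N : nat).
Hypothesis tau01 : forall i, (1 <= i <= N)%nat -> 0 <= tau i <= 1.

Lemma peano_0 k : peano a tau N (S k) 0 = remainder (nodal a tau N) (monom (S k)).
Proof.
rewrite <- remainder_tpow by lra. unfold remainder.
rewrite (nodal_ext a tau N (tpow (S k) 0) (monom (S k))).
2:{ intros i Hi. apply tpow_0. now apply tau01. }
rewrite (RInt_ext (tpow (S k) 0) (monom (S k))); trivial.
intros x. rewrite Rmin_left by lra. intros Hx. apply tpow_0; lra.
Qed.

Lemma peano_1 k : peano a tau N (S k) 1 = 0.
Proof.
unfold peano. rewrite (nodal_ext a tau N _ (fun _ => 0)).
2:{ intros i Hi. destruct (tau01 i Hi). unfold tpow. rewrite pos_nonpos by lra.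
    rewrite pow_i by lia. ring. }
replace (nodal a tau N (fun _ => 0)) with 0.
- rewrite Rminus_diag, pow_i by lia. unfold Rdiv. ring.
- clear. induction N as [|M IH]; [now rewrite nodal_0|rewrite nodal_S, <- IH; ring].
Qed.

Lemma peano_nonpos01 c t :
  negative_definite4 (nodal a tau N) c -> 0 <= t <= 1 -> peano a tau N 3 t <= 0.
Proof.
intros HQ Ht.
destruct (Req_dec t 0) as [->|H0].
{ rewrite peano_0. destruct (proj2 HQ _ _ C4_monom_3) as (xi & _ & ->). lra. }
destruct (Req_dec t 1) as [->|H1].
{ rewrite peano_1. lra. }
apply peano_nonpos with c; trivial. lra.
Qed.

(** A knot outside the open cell contributes either nothing or a full power, so on
    the cell the sums of truncated powers are polynomials, each the derivative of
    the next up to sign. *)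
Lemma nodal_cubic l r :
  (forall i, (1 <= i <= N)%nat -> tau i <= l \/ r <= tau i) ->
  exists b0 b1 b2 b3 b4, forall t, l <= t <= r ->
  let x := t - (l + r) / 2 in
  nodal a tau N (tpow 1 t) = b0 + b1 * x /\
  nodal a tau N (tpow 2 t) = b2 - b0 * x - b1 * x ^ 2 / 2 /\
  nodal a tau N (tpow 3 t) = b3 - b2 * x + b0 * x ^ 2 / 2 + b1 * x ^ 3 / 6 /\
  nodal a tau N (tpow 4 t) = b4 - b3 * x + b2 * x ^ 2 / 2 - b0 * x ^ 3 / 6 - b1 * x ^ 4 / 24.
Proof.
clear tau01. intros H. induction N as [|M IH].
- exists 0, 0, 0, 0, 0. intros t _ x. rewrite !nodal_0. lra.
- destruct IH as (b0 & b1 & b2 & b3 & b4 & IH); [intros i Hi; apply H; lia|].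
  destruct (H (S M) ltac:(lia)) as [Hl|Hr].
  + exists b0, b1, b2, b3, b4. intros t Ht x. rewrite !nodal_S. unfold tpow at 2 4 6 8.
    rewrite pos_nonpos by lra. rewrite !pow_i by lia. rewrite !Rmult_0_r, !Rplus_0_r.
    now apply IH.
  + set (d := tau (S M) - (l + r) / 2). set (w := a (S M)).
    exists (b0 + w * d), (b1 - w), (b2 + w * d ^ 2 / 2), (b3 + w * d ^ 3 / 6), (b4 + w * d ^ 4 / 24).
    intros t Ht x. rewrite !nodal_S. unfold tpow at 2 4 6 8.
    rewrite pos_nonneg by lra. destruct (IH t Ht) as (-> & -> & -> & ->). fold x w.
    replace (tau (S M) - t) with (d - x) by (unfold d, x; ring).
    repeat split; simpl fact; simpl INR; field.
Qed.

Lemma peano_quartic_on l r :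
  (forall i, (1 <= i <= N)%nat -> tau i <= l \/ r <= tau i) ->
  quartic_on (fun t => - peano a tau N 4 t) (peano a tau N 3)
             (fun t => - peano a tau N 2 t) (peano a tau N 1) l r.
Proof.
intros H. destruct (nodal_cubic l r H) as (b0 & b1 & b2 & b3 & b4 & Hb).
set (w := 1 - (l + r) / 2).
exists (- 4 * w - 4 * b1), (6 * w ^ 2 - 12 * b0), (- 4 * w ^ 3 + 24 * b2),
  (24 * b3 - w ^ 4), (b4 - w ^ 5 / 120).
intros t Ht x. unfold peano. destruct (Hb t Ht) as (-> & -> & -> & ->). fold x.
replace (1 - t) with (w - x) by (unfold w, x; ring).
repeat split; simpl fact; simpl INR; field.
Qed.

Hypothesis tau_lt : forall i j, (1 <= i)%nat -> (i < j)%nat -> (j <= N)%nat -> tau i < tau j.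

(** The nodes, completed by the ends of [[0, 1]]. A cell may be empty, when 0 or 1 is a
    node. *)
Definition breakpoint (j : nat) : R :=
  match j with O => 0 | _ => if Nat.leb j N then tau j else 1 end.

Lemma breakpoint_node j : (1 <= j <= N)%nat -> breakpoint j = tau j.
Proof.
intros Hj. unfold breakpoint. destruct j; [lia|]. now rewrite (proj2 (Nat.leb_le _ _)) by lia.
Qed.

Lemma breakpoint_last : breakpoint (S N) = 1.
Proof. unfold breakpoint. now rewrite (proj2 (Nat.leb_gt _ _)) by lia. Qed.

Lemma breakpoint_01 j : (j <= S N)%nat -> 0 <= breakpoint j <= 1.
Proof.
intros Hj. destruct (Nat.eq_dec j 0) as [->|H0]; [simpl; lra|].
destruct (Nat.eq_dec j (S N)) as [->|H1]; [rewrite breakpoint_last; lra|].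
rewrite breakpoint_node by lia. apply tau01. lia.
Qed.

Lemma tau_breakpoint_le i j : (1 <= i <= N)%nat -> (i <= j <= S N)%nat -> tau i <= breakpoint j.
Proof.
intros Hi Hj. destruct (Nat.eq_dec j (S N)) as [->|H1].
{ rewrite breakpoint_last. now apply tau01. }
rewrite breakpoint_node by lia. destruct (Nat.eq_dec i j) as [->|Hne]; [lra|].
left. apply tau_lt; lia.
Qed.

Lemma tau_breakpoint_ge i j : (1 <= i <= N)%nat -> (j <= i)%nat -> breakpoint j <= tau i.
Proof.
intros Hi Hj. destruct (Nat.eq_dec j 0) as [->|H0]; [now apply tau01|].
rewrite breakpoint_node by lia. destruct (Nat.eq_dec i j) as [->|Hne]; [lra|].
left. apply tau_lt; lia.
Qed.

Lemma breakpoint_step j : (j <= N)%nat -> breakpoint j <= breakpoint (S j).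
Proof.
intros Hj. destruct (Nat.eq_dec j 0) as [->|H0].
- simpl breakpoint at 1. apply breakpoint_01. lia.
- rewrite (breakpoint_node j) by lia. apply tau_breakpoint_le; lia.
Qed.

(** The cell inequalities telescope: the kernel has vanishing slope at 0 and 1 (at 0
    by exactness on quadratic polynomials), so the potential vanishes there, and the
    integral of the kernel is [c]. With [N + 1] cells the best reference
    length is [1 / (N + 1)]. *)
Lemma definite_upper_bound c :
  negative_definite4 (nodal a tau N) c -> c <= - kappa / INR (S N) ^ 4.
Proof.
intros HQ.
assert (HN : 0 < INR (S N)) by (apply lt_0_INR; lia).
set (H := / INR (S N)). assert (HH : 0 < H) by now apply Rinv_0_lt_compat.
set (B := potential H (fun t => - peano a tau N 2 t) (peano a tau N 1)).
assert (Hsum : forall j, (j <= S N)%nat ->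
  - peano a tau N 4 (breakpoint j) + peano a tau N 4 0
  + kappa * (5 * H ^ 4 * breakpoint j - 4 * H ^ 5 * INR j) <= B (breakpoint j) - B 0).
{ induction j as [|j IH]; intros Hj.
  - simpl breakpoint. simpl INR. lra.
  - specialize (IH ltac:(lia)).
    assert (Hcell := cell_increment _ _ _ _ (breakpoint j) (breakpoint (S j)) H
      (breakpoint_step j ltac:(lia)) ltac:(lra)
      (peano_quartic_on (breakpoint j) (breakpoint (S j)) ltac:(
         intros i Hi; destruct (Nat.le_gt_cases i j);
          [left; apply tau_breakpoint_le|right; apply tau_breakpoint_ge]; lia))
      ltac:(intros t Ht; apply peano_nonpos01 with c; trivial;
            assert (H1 := breakpoint_01 j ltac:(lia));
            assert (H2 := breakpoint_01 (S j) ltac:(lia)); lra)).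
    fold B in Hcell. rewrite S_INR. cbv beta in Hcell. lra. }
specialize (Hsum (S N) (Nat.le_refl _)). rewrite breakpoint_last in Hsum.
assert (B0 : forall t, peano a tau N 2 t = 0 -> B t = 0).
{ intros t Ht. unfold B, potential. rewrite Ht.
  replace (- 0 * peano a tau N 1 t / 2) with 0 by field.
  assert (0 < H ^ 5) by now apply pow_lt.
  unfold clamp, Rmax, Rmin, kappa. repeat destruct Rle_dec; lra. }
assert (E2 : peano a tau N 2 0 = 0).
{ rewrite peano_0. destruct (proj2 HQ _ _ C4_monom_2) as (xi & _ & ->). ring. }
assert (E4 : peano a tau N 4 0 = c).
{ rewrite peano_0. destruct (proj2 HQ _ _ C4_monom_4) as (xi & _ & ->). ring. }
rewrite (B0 1 (peano_1 1)), (B0 0 E2), peano_1, E4 in Hsum.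
replace (- kappa / INR (S N) ^ 4) with (- (kappa * (5 * H ^ 4 * 1 - 4 * H ^ 5 * INR (S N)))).
- lra.
- unfold H. field. lra.
Qed.

End Peano.

(** * Local Peano estimates for the given formula *)

(** Composition with the projection onto [[0, 1]] turns one-sided continuity at 0 and 1
    into continuity on the whole line, while keeping derivatives inside. *)
Definition proj01 (x : R) : R := Rmax 0 (Rmin x 1).

Lemma proj01_in x : 0 <= proj01 x <= 1.
Proof. unfold proj01, Rmax, Rmin. repeat destruct Rle_dec; lra. Qed.

Lemma proj01_id x : 0 <= x <= 1 -> proj01 x = x.
Proof. intros Hx. unfold proj01, Rmax, Rmin. repeat destruct Rle_dec; lra. Qed.

Lemma proj01_contract x y : Rabs (proj01 y - proj01 x) <= Rabs (y - x).
Proof.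
unfold proj01, Rmax, Rmin, Rabs. repeat destruct Rle_dec; repeat destruct Rcase_abs; lra.
Qed.

Lemma continuous_proj01 f x : continuous_on01 f -> continuous (fun y => f (proj01 y)) x.
Proof.
intros Hf. apply (continuity_pt_filterlim (fun y => f (proj01 y))).
intros eps Heps. destruct (Hf (proj01 x) (proj01_in x) eps Heps) as (d & Hd & H).
exists d; split; trivial. intros y [_ Hy].
destruct (Req_dec (proj01 x) (proj01 y)) as [E|E].
- simpl. unfold Rdist. rewrite E, Rminus_diag, Rabs_R0. exact Heps.
- apply H. split; [split; [apply proj01_in|exact E]|].
  eapply Rle_lt_trans; [apply proj01_contract|exact Hy].
Qed.

Lemma is_derive_proj01 f f' x : derivative_on01 f f' -> 0 < x < 1 ->
  is_derive (fun y => f (proj01 y)) x (f' (proj01 x)).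
Proof.
intros Hf Hx. apply is_derive_Reals. intros eps Heps.
destruct (Hf x (conj (Rlt_le _ _ (proj1 Hx)) (Rlt_le _ _ (proj2 Hx))) eps Heps) as (d & Hd & H).
assert (Hd' : 0 < Rmin d (Rmin x (1 - x))) by (repeat apply Rmin_pos; lra).
exists (mkposreal _ Hd'). intros h Hh Hlt. simpl in Hlt.
assert (H1 := Rmin_l d (Rmin x (1 - x))). assert (H2 := Rmin_r d (Rmin x (1 - x))).
assert (H3 := Rmin_l x (1 - x)). assert (H4 := Rmin_r x (1 - x)).
destruct (Rabs_def2 h _ Hlt) as [H5 H6].
rewrite !proj01_id by lra.
specialize (H (x + h)). simpl in H. unfold Rdist in H.
replace (x + h - x) with h in H by ring.
apply H. split; [split; [unfold I01; lra|lra]|lra].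
Qed.

Definition smooth4 (g g1 g2 g3 g4 : R -> R) :=
  (forall x, continuous g x) /\ (forall x, continuous g1 x) /\
  (forall x, continuous g2 x) /\ (forall x, continuous g3 x) /\
  forall x, 0 < x < 1 ->
    is_derive g x (g1 x) /\ is_derive g1 x (g2 x) /\
    is_derive g2 x (g3 x) /\ is_derive g3 x (g4 x).

Lemma derivative_on01_continuous f f' : derivative_on01 f f' -> continuous_on01 f.
Proof. intros H x Hx. eapply cont_deriv, H, Hx. Qed.

Lemma C4_smooth4 f f4 : C4_on01 f f4 ->
  exists g1 g2 g3,
    smooth4 (fun x => f (proj01 x)) g1 g2 g3 (fun x => f4 (proj01 x)).
Proof.
intros (f1 & f2 & f3 & H0 & H1 & H2 & H3 & _).
exists (fun x => f1 (proj01 x)), (fun x => f2 (proj01 x)), (fun x => f3 (proj01 x)).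
assert (C := fun u u' H x => continuous_proj01 u x (derivative_on01_continuous u u' H)).
refine (conj (C _ _ H0) (conj (C _ _ H1) (conj (C _ _ H2) (conj (C _ _ H3) _)))).
intros x Hx.
exact (conj (is_derive_proj01 f f1 x H0 Hx) (conj (is_derive_proj01 f1 f2 x H1 Hx)
  (conj (is_derive_proj01 f2 f3 x H2 Hx) (is_derive_proj01 f3 f4 x H3 Hx)))).
Qed.

Lemma smooth4_opp g g1 g2 g3 g4 : smooth4 g g1 g2 g3 g4 ->
  smooth4 (fun x => - g x) (fun x => - g1 x) (fun x => - g2 x) (fun x => - g3 x) (fun x => - g4 x).
Proof.
intros (C0 & C1 & C2 & C3 & D).
assert (C : forall u : R -> R, (forall x, continuous u x) -> forall x, continuous (fun y => - u y) x).
{ intros u Hu x. exact (continuous_opp u x (Hu x)). }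
refine (conj (C _ C0) (conj (C _ C1) (conj (C _ C2) (conj (C _ C3) _)))).
intros x Hx. destruct (D x Hx) as (D0 & D1 & D2 & D3).
exact (conj (is_derive_opp _ _ _ D0) (conj (is_derive_opp _ _ _ D1)
  (conj (is_derive_opp _ _ _ D2) (is_derive_opp _ _ _ D3)))).
Qed.

Section Formula.

Variables (g g1 g2 g3 g4 F : R -> R) (m : R).
Hypothesis Hg : smooth4 g g1 g2 g3 g4.
Hypothesis HF : forall x, is_derive F x (g x).
Hypothesis Hm : forall x, 0 <= x <= 1 -> m <= g4 x.

(** With [k] the quartic of leading coefficient [1 / 24] and lower coefficients
    [c3 / 6], [c2 / 2], [c1], [c0] in [y], this is
    [k g3 - k' g2 + k'' g1 - k''' g], whose derivative is [k g4 - g]. *)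
Definition boundary_form (c3 c2 c1 c0 y x : R) : R :=
  (y ^ 4 / 24 + c3 * y ^ 3 / 6 + c2 * y ^ 2 / 2 + c1 * y + c0) * g3 x
  - (y ^ 3 / 6 + c3 * y ^ 2 / 2 + c2 * y + c1) * g2 x
  + (y ^ 2 / 2 + c3 * y + c2) * g1 x - (y + c3) * g x.

Definition quartic_primitive (c3 c2 c1 c0 y : R) : R :=
  y ^ 5 / 120 + c3 * y ^ 4 / 24 + c2 * y ^ 3 / 6 + c1 * y ^ 2 / 2 + c0 * y.

(** Where the kernel [k] is nonpositive, [k g4 <= m k]; integrating by parts four
    times leaves only boundary terms. *)
Lemma peano_piece c3 c2 c1 c0 z a b : 0 <= a -> a < b -> b <= 1 ->
  (forall t, a <= t <= b ->
    (t - z) ^ 4 / 24 + c3 * (t - z) ^ 3 / 6 + c2 * (t - z) ^ 2 / 2 + c1 * (t - z) + c0 <= 0) ->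
  boundary_form c3 c2 c1 c0 (b - z) b - boundary_form c3 c2 c1 c0 (a - z) a + (F b - F a)
  <= m * (quartic_primitive c3 c2 c1 c0 (b - z) - quartic_primitive c3 c2 c1 c0 (a - z)).
Proof.
intros Ha Hab Hb Hk.
destruct Hg as (C0 & C1 & C2 & C3 & D).
set (G := fun t => boundary_form c3 c2 c1 c0 (t - z) t + F t - m * quartic_primitive c3 c2 c1 c0 (t - z)).
assert (cont : forall u : R -> R, (forall x, continuous u x) -> forall x, continuity_pt u x).
{ intros u Hu x. apply continuity_pt_filterlim, Hu. }
destruct (MVT_gen G a b (fun t =>
  ((t - z) ^ 4 / 24 + c3 * (t - z) ^ 3 / 6 + c2 * (t - z) ^ 2 / 2 + c1 * (t - z) + c0)
  * (g4 t - m))) as (x & Hx & E).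
- rewrite Rmin_left, Rmax_right by lra. intros x Hx.
  destruct (D x ltac:(lra)) as (D0 & D1 & D2 & D3). assert (DF := HF x).
  unfold G, boundary_form, quartic_primitive. auto_derive.
  + repeat split; eexists; eassumption.
  + assert (eta : forall (u : R -> R) l, is_derive u x l -> Derive (fun y => u y) x = l)
      by (intros u l Hu; apply is_derive_unique, Hu).
    rewrite (eta _ _ D0), (eta _ _ D1), (eta _ _ D2), (eta _ _ D3), (eta _ _ DF).
    field.
- intros x _. unfold G, boundary_form, quartic_primitive.
  assert (CF : continuity_pt F x).
  { apply derivable_continuous_pt. exists (g x). apply is_derive_Reals, HF. }
  assert (P : forall u, ex_derive u x -> continuity_pt u x).
  { intros u Hu. apply continuity_pt_filterlim. now apply (ex_derive_continuous u). }
  repeat (cbv beta; first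
    [ exact (cont g C0 x) | exact (cont g1 C1 x) | exact (cont g2 C2 x)
    | exact (cont g3 C3 x) | exact CF
    | match goal with
      | |- continuity_pt (fun t => @?u t + @?v t) _ => apply (continuity_pt_plus u v)
      | |- continuity_pt (fun t => @?u t - @?v t) _ => apply (continuity_pt_minus u v)
      | |- continuity_pt (fun t => @?u t * @?v t) _ => apply (continuity_pt_mult u v)
      end ]);
    apply P; auto_derive; trivial.
- rewrite Rmin_left, Rmax_right in Hx by lra.
  assert (H1 := Hk x Hx). assert (H2 := Hm x ltac:(lra)).
  match type of E with _ = ?u * (_ - _) * _ => set (k := u) in * end.
  assert (0 <= (- k) * (g4 x - m) * (b - a)) by (repeat apply Rmult_le_pos; lra).
  unfold G in E. lra.
Qed.

Variable h : R.
Hypothesis Hh : 0 < h.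

(** One panel of the midpoint rule with a correction by the end slopes. Its kernel is
    [s^2 (s^2 - h^2 / 2) / 24], with [s] the distance to the nearer end of
    the cell. *)
Lemma middle_cell z : 0 <= z -> z + h <= 1 ->
  F (z + h) - F z - h * g (z + h / 2) - h ^ 2 / 24 * (g1 (z + h) - g1 z)
  <= m * (- 7 / 5760 * h ^ 5).
Proof.
intros Hz Hz1.
assert (K : forall y, - h / 2 <= y <= h / 2 ->
  y ^ 4 / 24 + 0 * y ^ 3 / 6 + (- h ^ 2 / 24) * y ^ 2 / 2 + 0 * y + 0 <= 0).
{ intros y Hy. assert (0 <= y ^ 2 * ((h / 2 - y) * (h / 2 + y) + (h / 2) ^ 2)).
  { apply Rmult_le_pos; [apply pow2_ge_0|].
    apply Rplus_le_le_0_compat; [apply Rmult_le_pos; lra|apply pow2_ge_0]. }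
  lra. }
assert (P1 := peano_piece 0 (- h ^ 2 / 24) 0 0 z z (z + h / 2) ltac:(lra) ltac:(lra) ltac:(lra)
  ltac:(intros t Ht; apply K; lra)).
assert (P2 := peano_piece 0 (- h ^ 2 / 24) 0 0 (z + h) (z + h / 2) (z + h) ltac:(lra) ltac:(lra) ltac:(lra)
  ltac:(intros t Ht; apply K; lra)).
replace (z - z) with 0 in P1 by ring. replace (z + h / 2 - z) with (h / 2) in P1 by ring.
replace (z + h - (z + h)) with 0 in P2 by ring.
replace (z + h / 2 - (z + h)) with (- (h / 2)) in P2 by field.
unfold boundary_form, quartic_primitive in P1, P2. lra.
Qed.

(** The three pieces of the kernel on the first interval of length [h]. The third
    one is written in the distance to [h]; there it matches the kernel of the middle
    cells up to the second derivative, and the node [h] accounts for the cubic term. *)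
Lemma end_kernel_1 y : 0 <= y <= h / 4 ->
  y ^ 4 / 24 - 7 * h / 24 * y ^ 3 / 6 <= 0.
Proof.
intros Hy. assert (0 <= y ^ 3 * (7 * h / 6 - y)).
{ apply Rmult_le_pos; [apply pow_le|]; lra. }
lra.
Qed.

Lemma end_kernel_2 y : h / 4 <= y <= h / 2 ->
  y ^ 4 / 24 - 7 * h / 24 * y ^ 3 / 6 + 2 / 27 * h * (y - h / 4) ^ 3 <= 0.
Proof.
intros Hy.
assert (H1 : (y - h / 4) ^ 3 <= (y / 2) ^ 3) by (apply pow_incr; lra).
apply (Rmult_le_compat_l h) in H1; [|lra].
assert (0 <= y ^ 3 * (h / 2 - y)).
{ apply Rmult_le_pos; [apply pow_le|]; lra. }
assert (0 <= h * y ^ 3) by (apply Rmult_le_pos; [|apply pow_le]; lra).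
lra.
Qed.

Lemma end_kernel_3 y : 0 <= y <= h / 2 ->
  y ^ 4 / 24 + h / 72 * y ^ 3 / 6 - h ^ 2 / 24 * y ^ 2 / 2 <= 0.
Proof.
intros Hy.
assert (0 <= y ^ 2 * ((h / 2 - y) * (h / 2 + y) + h / 18 * (h / 2 - y) + 2 / 9 * h ^ 2)).
{ apply Rmult_le_pos; [apply pow2_ge_0|].
  repeat apply Rplus_le_le_0_compat; repeat apply Rmult_le_pos; try apply pow_le; lra. }
lra.
Qed.

Lemma left_end : h <= 1 ->
  F h - F 0 - 7 / 24 * h * g 0 + 4 / 9 * h * g (h / 4) - 7 / 6 * h * g (h / 2)
  + h / 72 * g h - h ^ 2 / 24 * g1 h <= m * (- 23 / 23040 * h ^ 5).
Proof.
intros Hh1.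
assert (P1 := peano_piece (- 7 * h / 24) 0 0 0 0 0 (h / 4) ltac:(lra) ltac:(lra) ltac:(lra)
  ltac:(intros t Ht; assert (K := end_kernel_1 t ltac:(lra)); lra)).
assert (P2 := peano_piece (11 * h / 72) (- h ^ 2 / 9) (h ^ 3 / 72) (- h ^ 4 / 864)
  0 (h / 4) (h / 2) ltac:(lra) ltac:(lra) ltac:(lra)
  ltac:(intros t Ht; assert (K := end_kernel_2 t ltac:(lra)); lra)).
assert (P3 := peano_piece (- h / 72) (- h ^ 2 / 24) 0 0 h (h / 2) h ltac:(lra) ltac:(lra) ltac:(lra)
  ltac:(intros t Ht; assert (K := end_kernel_3 (h - t) ltac:(lra)); lra)).
rewrite !Rminus_0_r in P1, P2.
replace (h - h) with 0 in P3 by ring. replace (h / 2 - h) with (- (h / 2)) in P3 by field.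
unfold boundary_form, quartic_primitive in P1, P2, P3. lra.
Qed.

Lemma right_end : h <= 1 ->
  F 1 - F (1 - h) - 7 / 24 * h * g 1 + 4 / 9 * h * g (1 - h / 4) - 7 / 6 * h * g (1 - h / 2)
  + h / 72 * g (1 - h) + h ^ 2 / 24 * g1 (1 - h) <= m * (- 23 / 23040 * h ^ 5).
Proof.
intros Hh1.
assert (P1 := peano_piece (7 * h / 24) 0 0 0 1 (1 - h / 4) 1 ltac:(lra) ltac:(lra) ltac:(lra)
  ltac:(intros t Ht; assert (K := end_kernel_1 (1 - t) ltac:(lra)); lra)).
assert (P2 := peano_piece (- (11 * h / 72)) (- h ^ 2 / 9) (- (h ^ 3 / 72)) (- h ^ 4 / 864)
  1 (1 - h / 2) (1 - h / 4) ltac:(lra) ltac:(lra) ltac:(lra)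
  ltac:(intros t Ht; assert (K := end_kernel_2 (1 - t) ltac:(lra)); lra)).
assert (P3 := peano_piece (h / 72) (- h ^ 2 / 24) 0 0 (1 - h) (1 - h) (1 - h / 2)
  ltac:(lra) ltac:(lra) ltac:(lra)
  ltac:(intros t Ht; assert (K := end_kernel_3 (t - (1 - h)) ltac:(lra)); lra)).
replace (1 - 1) with 0 in P1 by ring.
replace (1 - h / 4 - 1) with (- (h / 4)) in P1, P2 by ring.
replace (1 - h / 2 - 1) with (- (h / 2)) in P2 by ring.
replace (1 - h - (1 - h)) with 0 in P3 by ring.
replace (1 - h / 2 - (1 - h)) with (h / 2) in P3 by field.
unfold boundary_form, quartic_primitive in P1, P2, P3. lra.
Qed.

End Formula.

(** * The formula with n + 6 nodes *)

Definition error_constant (n : nat) : R :=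
  - (7 / (5760 * INR n ^ 4)) * (1 - 5 / (14 * INR n)).

(** Nodes in units of [1 / (4 n)] and weights in units of [1 / n], so that their order
    is a matter of linear arithmetic. *)
Definition node_scaled (n i : nat) : R :=
  match i with
  | 1%nat => 0 | 2%nat => 1 | 3%nat => 2 | 4%nat => 4
  | _ => if Nat.leb i (n + 2) then 4 * INR i - 14
         else if Nat.eqb i (n + 3) then 4 * INR n - 4
         else if Nat.eqb i (n + 4) then 4 * INR n - 2
         else if Nat.eqb i (n + 5) then 4 * INR n - 1
         else 4 * INR n
  end.

Definition weight_scaled (n i : nat) : R :=
  match i with
  | 1%nat => 7 / 24 | 2%nat => - (4 / 9) | 3%nat => 7 / 6 | 4%nat => - (1 / 72)
  | _ => if Nat.leb i (n + 2) then 1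
         else if Nat.eqb i (n + 3) then - (1 / 72)
         else if Nat.eqb i (n + 4) then 7 / 6
         else if Nat.eqb i (n + 5) then - (4 / 9)
         else 7 / 24
  end.

Ltac index_cases :=
  repeat match goal with
  | |- context [Nat.leb ?x ?y] => destruct (Nat.leb_spec x y)
  | |- context [Nat.eqb ?x ?y] => destruct (Nat.eqb_spec x y)
  end.

Lemma node_scaled_lt n i : (3 <= n)%nat -> (1 <= i < n + 6)%nat ->
  node_scaled n i < node_scaled n (S i).
Proof.
intros Hn Hi. assert (H3 := le_INR _ _ Hn). simpl in H3.
destruct i as [|[|[|[|i]]]]; [lia|simpl; lra|simpl; lra|simpl; lra|].
destruct i as [|i]; [unfold node_scaled; index_cases; try lia; simpl INR; lra|].
unfold node_scaled. rewrite (S_INR (S (S (S (S (S i)))))). set (j := S (S (S (S (S i))))) in *. clearbody j.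
assert (Hj : (j <= n + 2)%nat -> INR j <= INR n + 2).
{ intros H. apply le_INR in H. rewrite plus_INR in H. simpl in H. lra. }
index_cases; try lia; try lra; specialize (Hj ltac:(lia)); lra.
Qed.

Lemma node_scaled_lt_trans n i j : (3 <= n)%nat -> (1 <= i)%nat -> (i < j)%nat ->
  (j <= n + 6)%nat -> node_scaled n i < node_scaled n j.
Proof.
intros Hn Hi Hij. induction Hij as [|j Hij IH]; intros Hj.
- apply node_scaled_lt; lia.
- eapply Rlt_trans; [apply IH; lia|apply node_scaled_lt; lia].
Qed.

Lemma node_scaled_last n : node_scaled n (n + 6) = 4 * INR n.
Proof.
replace (n + 6)%nat with (S (S (S (S (S (S n)))))) by lia. unfold node_scaled.
index_cases; lia || reflexivity.
Qed.

Lemma Qform_is_quadrature n : (3 <= n)%nat -> is_quadrature (n + 6) (Qform n).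
Proof.
intros Hn. assert (H3 := le_INR _ _ Hn). simpl in H3.
assert (Hi : 0 < / (4 * INR n)) by (apply Rinv_0_lt_compat; lra).
exists (fun i => weight_scaled n i / INR n), (fun i => node_scaled n i / (4 * INR n)).
split; [|split].
- intros i Hi'.
  assert (L : 0 <= node_scaled n i).
  { destruct (Nat.eq_dec i 1) as [->|Hne]; [simpl; lra|].
    left. apply (node_scaled_lt_trans n 1 i); lia. }
  assert (U : node_scaled n i <= 4 * INR n).
  { rewrite <- node_scaled_last. destruct (Nat.eq_dec i (n + 6)) as [->|Hne]; [lra|].
    left. apply node_scaled_lt_trans; lia. }
  split; [apply Rdiv_le_0_compat; lra|].
  rewrite <- (Rinv_r (4 * INR n)) by lra. apply Rmult_le_compat_r; lra.
- intros i j H1 H2 H4'. apply Rmult_lt_compat_r; trivial. now apply node_scaled_lt_trans.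
- intros f.
  destruct n as [|[|[|n]]]; try lia. set (k := S (S (S n))) in *.
  replace (k + 6)%nat with (S (S (S (S (S (S (S (S (S n))))))))) by (unfold k; lia).
  do 4 rewrite (sum_Sn_m _ _ (S _)) by lia.
  do 4 rewrite sum_n_Sm by lia.
  do 3 rewrite <- sum_n_m_S.
  match goal with |- _ = ?r => match r with context [sum_n_m ?u 2 ?m] =>
    rewrite (sum_n_m_ext_loc u
      (fun i => mult (/ INR k) (f ((2 * INR i - 1) / (2 * INR k)))) 2 m) end end.
  2:{ intros i Hi'. unfold weight_scaled, node_scaled. destruct i as [|[|i]]; try lia.
      index_cases; try (unfold k in *; lia). change mult with Rmult.
      rewrite !S_INR. replace (1 / INR k) with (/ INR k) by (field; lra).
      apply f_equal, f_equal. field. lra. }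
  rewrite (sum_n_m_mult_l (K := R_Ring)).
  unfold Qform, Defs.sigma. replace (k - 1)%nat with (S (S n)) by (unfold k; lia).
  unfold weight_scaled, node_scaled.
  index_cases; try (unfold k in *; lia).
  change plus with Rplus. change mult with Rmult.
  set (X := sum_n_m _ _ _).
  replace (0 / (4 * INR k)) with 0 by (field; lra).
  replace (2 / (4 * INR k)) with (1 / (2 * INR k)) by (field; lra).
  replace (4 / (4 * INR k)) with (1 / INR k) by (field; lra).
  replace ((4 * INR k - 4) / (4 * INR k)) with (1 - 1 / INR k) by (field; lra).
  replace ((4 * INR k - 2) / (4 * INR k)) with (1 - 1 / (2 * INR k)) by (field; lra).
  replace ((4 * INR k - 1) / (4 * INR k)) with (1 - 1 / (4 * INR k)) by (field; lra).
  replace (4 * INR k / (4 * INR k)) with (1 - 0) by (field; lra).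
  field. lra.
Qed.

(** The slope corrections of neighbouring middle cells cancel. *)
Lemma middle_sum n g g1 g2 g3 g4 F m j :
  smooth4 g g1 g2 g3 g4 -> (forall x, is_derive F x (g x)) ->
  (forall x, 0 <= x <= 1 -> m <= g4 x) ->
  let h := / INR n in
  (S j <= n)%nat ->
  F (INR (S j) * h) - F h
  - h * sum_n_m (fun k => g ((2 * INR k - 1) / (2 * INR n))) 2 (S j)
  - h ^ 2 / 24 * (g1 (INR (S j) * h) - g1 h) <= m * (- 7 / 5760 * h ^ 5) * INR j.
Proof.
intros Hg HF Hm h. 
induction j as [|j IH]; intros Hj.
- rewrite sum_n_m_zero by lia. change zero with 0. simpl INR. rewrite Rmult_1_l. lra.
- specialize (IH ltac:(lia)).
  assert (Hn : 0 < INR n) by (apply lt_0_INR; lia).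
  assert (Hh : 0 < h) by now apply Rinv_0_lt_compat.
  assert (Hn1 : INR n * h = 1) by (unfold h; field; lra).
  assert (Hz0 : 0 <= INR (S j) * h) by (apply Rmult_le_pos; [apply pos_INR|lra]).
  assert (Hz : INR (S j) * h + h <= 1).
  { rewrite <- Hn1. replace (INR (S j) * h + h) with (INR (S (S j)) * h)
      by (rewrite (S_INR (S j)); ring).
    apply Rmult_le_compat_r; [lra|]. now apply le_INR. }
  assert (H := middle_cell g g1 g2 g3 g4 F m Hg HF Hm h Hh _ Hz0 Hz).
  rewrite sum_n_Sm by lia. change plus with Rplus.
  replace ((2 * INR (S (S j)) - 1) / (2 * INR n)) with (INR (S j) * h + h / 2)
    by (rewrite (S_INR (S j)); unfold h; field; lra).
  rewrite (S_INR (S j)), (S_INR j) in *.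
  replace ((INR j + 1 + 1) * h) with ((INR j + 1) * h + h) by ring.
  lra.
Qed.

(** The slopes left over at [1 / n] and [1 - 1 / n] cancel against those of the two
    end intervals. *)
Lemma Qform_upper n g g1 g2 g3 g4 F m : (3 <= n)%nat ->
  smooth4 g g1 g2 g3 g4 -> (forall x, is_derive F x (g x)) ->
  (forall x, 0 <= x <= 1 -> m <= g4 x) ->
  F 1 - F 0 - Qform n g <= m * error_constant n.
Proof.
intros Hn Hg HF Hm. assert (H3 := le_INR _ _ Hn). simpl in H3.
set (h := / INR n).
assert (Hh : 0 < h) by (apply Rinv_0_lt_compat; lra).
assert (Hh1 : h <= 1) by (unfold h; rewrite <- Rinv_1; apply Rinv_le_contravar; lra).
assert (L := left_end g g1 g2 g3 g4 F m Hg HF Hm h Hh Hh1).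
assert (U := right_end g g1 g2 g3 g4 F m Hg HF Hm h Hh Hh1).
assert (C := middle_sum n g g1 g2 g3 g4 F m (n - 2) Hg HF Hm ltac:(lia)).
cbv zeta in C. fold h in C.
replace (S (n - 2)) with (n - 1)%nat in C by lia.
rewrite !minus_INR in C by lia. simpl (INR 1) in C. simpl (INR 2) in C.
replace ((INR n - 1) * h) with (1 - h) in C by (unfold h; field; lra).
unfold Qform, Defs.sigma.
set (X := sum_n_m _ _ _) in *.
replace (1 / (4 * INR n)) with (h / 4) by (unfold h; field; lra).
replace (1 / (2 * INR n)) with (h / 2) by (unfold h; field; lra).
replace (1 / INR n) with h by (unfold h; field; lra).
replace (7 / (24 * INR n)) with (7 / 24 * h) by (unfold h; field; lra).
replace (4 / (9 * INR n)) with (4 / 9 * h) by (unfold h; field; lra).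
replace (7 / (6 * INR n)) with (7 / 6 * h) by (unfold h; field; lra).
replace (1 / (72 * INR n)) with (h / 72) by (unfold h; field; lra).
replace (error_constant n) with
  (- 7 / 5760 * h ^ 5 * (INR n - (1 + 1)) + 2 * (- 23 / 23040 * h ^ 5))
  by (unfold error_constant, h; field; lra).
rewrite Rminus_0_r. lra.
Qed.

Lemma Qform_ext n f g : (3 <= n)%nat ->
  (forall x, 0 <= x <= 1 -> f x = g x) -> Qform n f = Qform n g.
Proof.
intros Hn H. destruct (Qform_is_quadrature n Hn) as (a & tau & Htau & _ & E).
rewrite !E. apply sum_n_m_ext_loc. intros i Hi. now rewrite H by now apply Htau.
Qed.

Lemma Qform_opp n f : Qform n (fun x => - f x) = - Qform n f.
Proof.
unfold Qform, Defs.sigma.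
set (u := fun k => f ((2 * INR k - 1) / (2 * INR n))).
assert (E : (sum_n_m (fun k => - u k) 2 (n - 1) : R) = - 1 * sum_n_m u 2 (n - 1)).
{ transitivity (sum_n_m (G := R_AbelianMonoid) (fun k => @mult R_Ring (- 1) (u k)) 2 (n - 1)).
  - apply sum_n_m_ext. intros k. change (- u k = - 1 * u k). ring.
  - exact (sum_n_m_mult_l (K := R_Ring) (- 1) u 2 (n - 1)). }
change (sum_n_m (fun k => - f ((2 * INR k - 1) / (2 * INR n))) 2 (n - 1))
  with (sum_n_m (fun k => - u k) 2 (n - 1)).
rewrite E. ring.
Qed.

Lemma error_constant_neg n : (3 <= n)%nat -> error_constant n < 0.
Proof.
intros Hn. assert (H3 := le_INR _ _ Hn). simpl in H3. unfold error_constant.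
assert (0 < 7 / (5760 * INR n ^ 4)).
{ apply Rdiv_lt_0_compat; [lra|]. apply Rmult_lt_0_compat; [lra|apply pow_lt; lra]. }
assert (0 < 1 - 5 / (14 * INR n)).
{ apply Rlt_0_minus. apply Rmult_lt_reg_r with (14 * INR n); [lra|]. field_simplify; lra. }
assert (0 < 7 / (5760 * INR n ^ 4) * (1 - 5 / (14 * INR n))) by now apply Rmult_lt_0_compat.
lra.
Qed.

(** [Qform_upper], for [f] and for [- f], places the remainder divided by the error
    constant between the extreme values of the fourth derivative; the intermediate
    value theorem provides the point. *)
Lemma Qform_negative_definite n : (3 <= n)%nat ->
  negative_definite4 (Qform n) (error_constant n).
Proof.
intros Hn. assert (Hc := error_constant_neg n Hn). split; trivial.
intros f f4 Hf.
destruct (C4_smooth4 f f4 Hf) as (g1 & g2 & g3 & Hg).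
set (g := fun x => f (proj01 x)) in *. set (g4 := fun x => f4 (proj01 x)) in *.
assert (C4 : forall x, continuity_pt g4 x).
{ intros x. apply continuity_pt_filterlim, continuous_proj01.
  now destruct Hf as (? & ? & ? & _ & _ & _ & _ & H). }
destruct (continuity_ab_min g4 0 1 ltac:(lra) ltac:(auto)) as (xm & Hm & Im).
destruct (continuity_ab_maj g4 0 1 ltac:(lra) ltac:(auto)) as (xM & HM & IM).
assert (Eg : forall a b, ex_RInt g a b).
{ intros a b. apply (ex_RInt_continuous (V := R_CompleteNormedModule)). intros x _. apply Hg. }
assert (DF : forall x, is_derive (fun y => RInt g 0 y) x (g x)).
{ intros x. apply (is_derive_RInt g (fun y => RInt g 0 y) 0 x); [|apply Hg].
  apply filter_forall. intros y. apply (RInt_correct g), Eg. }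
assert (ER : remainder (Qform n) f = RInt g 0 1 - Qform n g).
{ unfold remainder. rewrite (Qform_ext n f g Hn).
  2:{ intros x Hx. unfold g. now rewrite proj01_id. }
  rewrite (RInt_ext f g); trivial. rewrite Rmin_left, Rmax_right by lra.
  intros x Hx. unfold g. rewrite proj01_id; lra. }
assert (U := Qform_upper n _ _ _ _ _ _ (g4 xm) Hn Hg DF Hm).
assert (L := Qform_upper n _ _ _ _ _ (fun x => - RInt g 0 x) (- g4 xM) Hn (smooth4_opp _ _ _ _ _ Hg)
  (fun x => is_derive_opp _ _ _ (DF x)) (fun x Hx => Ropp_le_contravar _ _ (HM x Hx))).
cbv beta in U, L. rewrite Qform_opp in L. rewrite RInt_point in U, L.
change zero with 0 in U, L.
set (r := remainder (Qform n) f) in *.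
set (c := error_constant n) in *.
assert (E : exists x, 0 <= x <= 1 /\ g4 x = r / c).
{ assert (B : g4 xm <= r / c <= g4 xM).
  { assert (Er : r = r / c * c) by (field; lra).
    split; apply Ropp_le_cancel; apply Rmult_le_reg_r with (- c); lra. }
  destruct (IVT_gen g4 xm xM (r / c)) as (x & Hx & E).
  - intros x. apply C4.
  - rewrite Rmin_left, Rmax_right by lra. exact B.
  - exists x. split; trivial. destruct Hx as [H1 H2]. split.
    + eapply Rle_trans; [|exact H1]. apply Rmin_glb; lra.
    + eapply Rle_trans; [exact H2|]. apply Rmax_lub; lra. }
destruct E as (x & Hx & E). exists x. split; trivial.
unfold g4 in E. rewrite proj01_id in E by trivial. rewrite E. field. lra.
Qed.

(** * Asymptotic optimality *)

Lemma quadrature_upper_bound N Q c :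
  is_quadrature N Q -> negative_definite4 Q c -> c <= - kappa / INR (S N) ^ 4.
Proof.
intros (a & tau & H01 & Hlt & E) [Hc HQ].
apply (definite_upper_bound a tau N H01 Hlt). split; trivial.
intros f f4 Hf. destruct (HQ f f4 Hf) as (xi & Hxi & Hr). exists xi. split; trivial.
rewrite <- Hr. unfold remainder. now rewrite E.
Qed.

Lemma c_minus4_bounds n : (3 <= n)%nat ->
  error_constant n <= c_minus4 (n + 6) <= - kappa / INR (S (n + 6)) ^ 4.
Proof.
intros Hn. unfold c_minus4.
set (E := fun c => exists Q, is_quadrature (n + 6) Q /\ negative_definite4 Q c).
destruct (Lub_Rbar_correct E) as [Hub Hleast].
assert (L := Hub (error_constant n) (ex_intro _ (Qform n)
  (conj (Qform_is_quadrature n Hn) (Qform_negative_definite n Hn)))).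
assert (U := Hleast (Finite (- kappa / INR (S (n + 6)) ^ 4)) ltac:(
  intros c (Q & HQ & Hd); exact (quadrature_upper_bound _ _ _ HQ Hd))).
destruct (Lub_Rbar E) as [l| |]; simpl in L, U; try contradiction.
simpl. lra.
Qed.

Lemma ratio_bounds n : (3 <= n)%nat ->
  1 <= error_constant n / c_minus4 (n + 6) <= (1 + 7 * / INR n) ^ 4.
Proof.
intros Hn. assert (H3 := le_INR _ _ Hn). simpl in H3.
destruct (c_minus4_bounds n Hn) as [L U].
rewrite S_INR, plus_INR in U. replace (INR 6) with 6 in U by (simpl; lra).
set (c := error_constant n) in *. set (d := c_minus4 (n + 6)) in *.
assert (P : 0 < (INR n + 6 + 1) ^ 4) by (apply pow_lt; lra).
assert (P' : 0 < INR n ^ 4) by (apply pow_lt; lra).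
assert (Hd : d < 0).
{ eapply Rle_lt_trans; [exact U|]. unfold kappa.
  assert (0 < 7 / 5760 / (INR n + 6 + 1) ^ 4) by (apply Rdiv_lt_0_compat; lra). lra. }
split; apply Rmult_le_reg_r with (- d); try lra.
- replace (c / d * - d) with (- c) by (field; lra). lra.
- replace (c / d * - d) with (- c) by (field; lra).
  apply Rle_trans with (kappa / INR n ^ 4).
  + unfold c, error_constant.
    assert (0 <= kappa / INR n ^ 4 * (5 / (14 * INR n))).
    { unfold kappa. apply Rmult_le_pos; apply Rdiv_le_0_compat; lra. }
    replace (7 / (5760 * INR n ^ 4)) with (kappa / INR n ^ 4) by (unfold kappa; field; lra). lra.
  + replace (kappa / INR n ^ 4) with
      ((1 + 7 * / INR n) ^ 4 * (kappa / (INR n + 6 + 1) ^ 4)) by (field; lra).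
    apply Rmult_le_compat_l; [|lra].
    apply pow_le. assert (0 < / INR n) by (apply Rinv_0_lt_compat; lra). lra.
Qed.

Lemma is_lim_seq_majorant : is_lim_seq (fun n => (1 + 7 * / INR n) ^ 4) 1.
Proof.
assert (H : is_lim_seq (fun n => / INR n) 0).
{ evar_last. apply is_lim_seq_inv; [apply is_lim_seq_INR|discriminate]. reflexivity. }
assert (H1 : is_lim_seq (fun n => 1 + 7 * / INR n) 1).
{ evar_last. apply is_lim_seq_plus'; [apply is_lim_seq_const|].
  apply is_lim_seq_mult'; [apply is_lim_seq_const|exact H]. f_equal; ring. }
evar_last. repeat (apply is_lim_seq_mult'; [exact H1|]). apply is_lim_seq_const.
f_equal; ring.
Qed.

Theorem mainTheorem7 :
  exists c4 : nat -> R,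
    (forall n : nat, (3 <= n)%nat ->
       is_quadrature (n + 6) (Qform n) /\
       negative_definite4 (Qform n) (c4 n) /\
       c4 n = - (7 / (5760 * INR n ^ 4)) * (1 - 5 / (14 * INR n))) /\
    is_lim_seq (fun n => c4 n / c_minus4 (n + 6)) 1.
Proof.
exists error_constant. split.
- intros n Hn. repeat split.
  + now apply Qform_is_quadrature.
  + now apply error_constant_neg.
  + now apply Qform_negative_definite.
- apply is_lim_seq_le_le_loc with (fun _ => 1) (fun n => (1 + 7 * / INR n) ^ 4).
  + exists 3%nat. exact ratio_bounds.
  + apply is_lim_seq_const.
  + exact is_lim_seq_majorant.
Qed.
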